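(* Let $d\ge 3$, $n\in\mathbb{N}_0$, $\lambda=\frac{d-2}{2}$ and $N=\dim\mathcal{H}_n^d$. There exists a fundamental system of degree $n$ on the sphere $\mathbb{S}^{d-1}$; that is, there exist points $x_1,\ldots,x_N\in\mathbb{S}^{d-1}$ such that $$\det\left[C_n^\lambda(\langle x_i,x_j\rangle)\right]_{i,j=1}^N>0.$$
   Context: $\mathbb{S}^{d-1}$ is the unit sphere in $\mathbb{R}^d$ and $\langle\cdot,\cdot\rangle$ is the standard inner product. $\mathcal{H}_n^d$ is the real vector space of real polynomials on $\mathbb{R}^d$ that are homogeneous of degree $n$ and harmonic ($\Delta P=0$ with $\Delta=\sum_{i=1}^d\partial_i^2$). For $\lambda>0$ the Gegenbauer polynomial is $$C_n^\lambda(t)=\frac{(\lambda)_n2^n}{n!}\sum_{0\le j\le n/2}\frac{(-\frac n2)_j(\frac{1-n}{2})_j}{j!\,(1-n-\lambda)_j}\,t^{n-2j},$$ where $(a)_k=a(a+1)\cdots(a+k-1)$, $(a)_0=1$. A collection of points $\{x_1,\ldots,x_N\}$ in $\mathbb{S}^{d-1}$, $N=\dim\mathcal{H}_n^d$, is called a fundamental system of degree $n$ if $\det[C_n^\lambda(\langle x_i,x_j\rangle)]_{i,j=1}^N>0$ with $\lambda=\frac{d-2}{2}$. *)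

(* Defs.v *)
From HB Require Import structures.
From mathcomp Require Import all_boot all_order all_algebra.
From mathcomp Require Import reals.
From mathcomp Require Import mpoly.

Set Implicit Arguments.
Unset Strict Implicit.
Unset Printing Implicit Defensive.

Import Order.TTheory GRing.Theory Num.Theory.

Local Open Scope ring_scope.

Section Sphere.
Variables (R : realType) (d : nat).
Implicit Types x y : 'rV[R]_d.

Definition inner x y : R := \sum_(i < d) x 0 i * y 0 i.

(* The norm `|x| of a matrix in the library is the maximum norm. *)
Definition euclidean_norm x : R := Num.sqrt (inner x x).

Definition on_unit_sphere x : Prop := euclidean_norm x = 1.

End Sphere.

Section Laplacian.
Variable R : realType.

Definition laplacian d (p : {mpoly R[d]}) : {mpoly R[d]} :=
  \sum_(i < d) p^`M(i)^`M(i).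

Lemma laplacian_is_linear d : linear (@laplacian d).
Proof.
move=> c p q; rewrite /laplacian scaler_sumr -big_split /=.
by apply: eq_bigr => i _; rewrite !mderivD !mderivZ.
Qed.

Lemma mderiv_homog d n (p : {mpoly R[d]}) i :
  p \is n.-homog -> p^`M(i) \is n.-1.-homog.
Proof.
move=> hp; apply/dhomogP => m; rewrite mcoeff_msupp mcoeff_deriv => nz.
have: p@_(m + U_(i)) != 0 by apply: contraNneq nz => ->; rewrite mul0rn.
rewrite -mcoeff_msupp => /(dhomog_mf hp) <-.
by rewrite /= mdegD mdeg1 addn1.
Qed.

Lemma laplacian_homog d n (p : {mpoly R[d]}) :
  p \is n.-homog -> laplacian p \is (n - 2).-homog.
Proof.
move=> hp; apply: rpred_sum => i _.
by rewrite subn2; do 2!apply: mderiv_homog.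
Qed.

(* For n < 2 the truncated degree n - 2 is harmless: the Laplacian is then 0,
   which is homogeneous of every degree. *)
Definition homog_laplacian d n (p : dhomog d R n) : dhomog d R (n - 2) :=
  DHomog (laplacian_homog (dhomog_is_dhomog p)).

Lemma homog_laplacian_is_linear d n : linear (@homog_laplacian d n).
Proof. by move=> c p q; apply: val_inj; apply: laplacian_is_linear. Qed.

HB.instance Definition _ d n :=
  GRing.isLinear.Build R (dhomog d R n) (dhomog d R (n - 2)) _
    (@homog_laplacian d n) (@homog_laplacian_is_linear d n).

(* The spaces [dhomog d.+1 R n] carry the vector space structure of the
   library, hence [d.-1.+1], which is [d] for d > 0. *)
Definition harmonic d n : {vspace dhomog d.-1.+1 R n} :=
  lker (linfun (@homog_laplacian d.-1.+1 n)).

Lemma harmonicP d n (p : dhomog d.-1.+1 R n) :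
  reflect (laplacian (mpoly_of_dhomog p) = 0) (p \in harmonic d n).
Proof.
rewrite memv_ker lfunE /= -(inj_eq val_inj); exact: eqP.
Qed.

End Laplacian.

Section Gegenbauer.
Variable R : realType.

Definition pochhammer (a : R) (k : nat) : R := \prod_(i < k) (a + i%:R).

(* For 0 < lambda and j <= n./2 no factor of pochhammer (1 - n - lambda) j
   vanishes. *)
Definition gegenbauer (lambda : R) (n : nat) : {poly R} :=
  (pochhammer lambda n * 2 ^+ n / n`!%:R) *:
    \sum_(j < n./2.+1)
      (pochhammer (- (n%:R / 2)) j * pochhammer ((1 - n%:R) / 2) j
        / (j`!%:R * pochhammer (1 - n%:R - lambda) j)) *: 'X^(n - 2 * j).

End Gegenbauer.

Definition fundamental_system (R : realType) (d n : nat)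
    (x : 'I_(\dim (harmonic R d n)) -> 'rV[R]_d) : Prop :=
  (forall i, on_unit_sphere (x i)) /\
  0 < \det (\matrix_(i, j)
        (gegenbauer ((d%:R - 2) / 2) n).[inner (x i) (x j)]).

(* Main.v *)
Require Import Defs.
From HB Require Import structures.
From mathcomp Require Import all_boot all_order all_algebra.
From mathcomp Require Import reals.
From mathcomp Require Import mpoly ring lra zify.

(* Pair polynomials by the Fischer form <X^a, X^b> = a! if a = b, 0 otherwise,
   for which multiplication by X_i is adjoint to the derivative along X_i. If q
   is homogeneous of degree n, then Euler's identity gives
   <(y.X)^n, q> = n! q(y). For |y| = 1 the Gegenbauer polynomial of x.y is
   C = (lambda)_n 2^n / n! times the restriction to the sphere of a harmonic
   polynomial Z_y(X) = (y.X)^n + |X|^2 (...), and the multiples of |X|^2 are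
   orthogonal to the harmonic polynomials; hence <Z_y, q> = n! q(y) for
   harmonic q. So [C_n(<x_i, x_j>)] is C / n! times the Gram matrix of the
   Z_(x_i), and its determinant is positive once the evaluations at the x_i are
   linearly independent on the harmonic polynomials. N such points on the sphere
   exist because a nonzero homogeneous polynomial does not vanish identically on
   the sphere. *)

Set Implicit Arguments.
Unset Strict Implicit.
Unset Printing Implicit Defensive.

Import Order.TTheory GRing.Theory Num.Theory.

Local Open Scope ring_scope.

(** * Linear algebra: positive determinants and independent evaluations *)

Lemma mulmx_tr_gt0 (R : realDomainType) N (v : 'rV[R]_N) :
  v != 0 -> 0 < (v *m v^T) 0 0.
Proof.
move=> /rV0Pn [i vi]; rewrite mxE (bigD1 i) //= mxE ltr_wpDr //.
  by apply: sumr_ge0 => j _; rewrite mxE -expr2 sqr_ge0.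
by rewrite -expr2 exprn_even_gt0.
Qed.

(* The segment from the identity to M stays in the cone of matrices with
   positive quadratic form, so the determinant cannot vanish along it. *)
Lemma det_gt0_of_posdef (R : rcfType) N (M : 'M[R]_N) :
  (forall v : 'rV_N, v != 0 -> 0 < (v *m M *m v^T) 0 0) -> 0 < \det M.
Proof.
move=> Mpos; rewrite ltNge; apply/negP => detM.
pose P : 'M[{poly R}]_N := (1 - 'X)%:M + 'X *: map_mx polyC M.
have PE t : map_mx (horner_eval t) P = (1 - t)%:M + t *: M.
  apply/matrixP => i j; rewrite !mxE /horner_eval !hornerE hornerMn.
  by rewrite !hornerE.
have detE t : (\det P).[t] = \det ((1 - t)%:M + t *: M).
  by rewrite -PE det_map_mx.
(* If det M <= 0, the polynomial - det P goes from -1 at 0 to a nonnegative value at 1, hence has a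
   root t in [0, 1]. *)
have [|t /andP[t0 t1]] := @poly_ivt R (- \det P) 0 1 ler01.
  rewrite !hornerN !detE subr0 subrr scale0r addr0 det1 scale1r raddf0 add0r.
  by rewrite oppr_ge0 detM oppr_le0 ler01.
rewrite rootE hornerN oppr_eq0 detE => /det0P [v vn0 v0].
have := congr1 (fun w : 'rV_N => (w *m v^T) 0 0) v0.
rewrite mul0mx mulmxDr mul_mx_scalar -scalemxAr mulmxDl -!scalemxAl !mxE.
have := mulmx_tr_gt0 vn0; have := Mpos _ vn0; rewrite !mxE.
set a := \sum_j _; set b := \sum_j _ => a0 b0 /eqP; apply/negP.
case: (ltrgtP t 0) t0 => // [t0 _|-> _]; apply: lt0r_neq0; nra.
Qed.

(** The points are chosen greedily: while k < N rows are chosen, some nonzero column c is killed by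
    all of them, and a point t with f(t) c nonzero supplies a row outside their span. *)
Lemma exists_row_free (F : fieldType) (T : Type) (P : T -> Prop) N
    (f : T -> 'rV[F]_N) :
    (forall c : 'cV_N, c != 0 -> exists2 t, P t & f t *m c != 0) ->
  exists2 x : 'I_N -> T, (forall i, P (x i)) & row_free (\matrix_i f (x i)).
Proof.
move=> sepf; suff: forall k, (k <= N)%N ->
    exists2 x : 'I_k -> T, (forall i, P (x i)) & row_free (\matrix_i f (x i)).
  by apply.
elim=> [_|k IHk ltkN].
  exists (fun i : 'I_0 => False_rect _ (notF (ltn_ord i))); first by case.
  by rewrite /row_free -leqn0 rank_leq_row.
have [x Px /row_freeP free_x] := IHk (ltnW ltkN).
set A := \matrix_i _ in free_x.
have : cokermx A != 0.
  rewrite -mxrank_eq0 mxrank_coker subn_eq0 -ltnNge.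
  exact: leq_ltn_trans (rank_leq_row _) ltkN.
move=> /matrix0Pn [i [j nzij]].
have [|t Pt ft] := sepf (col j (cokermx A)).
  by apply/cV0Pn; exists i; rewrite mxE.
have Ac : A *m col j (cokermx A) = 0.
  by rewrite colE mulmxA mulmx_coker mul0mx.
pose y (i : 'I_(1 + k)) := if split i is inr i' then x i' else t.
exists y => [i'|]; first by rewrite /y; case: split.
have -> : \matrix_i' f (y i') = col_mx (f t) A.
  apply/row_matrixP => i'; rewrite rowK /y; case: (split_ordP i') => i'' ->.
    by rewrite (@rowKu _ 1) row_id.
  by rewrite (@rowKd _ 1) rowK.
apply: (@inj_row_free _ (1 + k)) => v; rewrite -[v]hsubmxK mul_row_col.
set v1 := lsubmx v; set v2 := rsubmx v => v0.
(* Multiplying the relation by the cokernel column kills the old rows and leaves v1 times a nonzero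
   scalar. *)
have v10 : v1 = 0.
  have := congr1 (fun w => w *m col j (cokermx A)) v0.
  rewrite mul0mx mulmxDl -!mulmxA Ac mulmx0 addr0.
  move: ft; rewrite [f t *m _]mx11_scalar mul_mx_scalar => ft /eqP.
  rewrite scaler_eq0 => /orP[/eqP ft0|/eqP //].
  by rewrite ft0 raddf0 eqxx in ft.
case: free_x => B AB; move: v0; rewrite v10 mul0mx add0r => v0.
by rewrite -[v2]mulmx1 -AB mulmxA v0 mul0mx row_mx0.
Qed.

(** * Nonzero polynomials take nonzero values *)

Section Nonvanishing.
Variable R : numDomainType.

Lemma exists_nonroot (q : {poly R}) : q != 0 -> exists t, q.[t] != 0.
Proof.
move=> q0; pose rs : seq R := [seq i%:R | i <- iota 0 (size q)].
have [/(max_poly_roots q0)|/allPn [t _ qt]] := boolP (all (root q) rs).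
  rewrite map_inj_uniq ?iota_uniq => [/(_ isT)|a b /eqP].
    by rewrite size_map size_iota ltnn.
  by rewrite eqr_nat => /eqP.
by exists t.
Qed.

Lemma base_expansion_inj B d (a b : 'I_d -> nat) :
    (forall i, a i < B)%N -> (forall i, b i < B)%N ->
  (\sum_i a i * B ^ i = \sum_i b i * B ^ i)%N -> a =1 b.
Proof.
elim: d a b => [|d IHd] a b aB bB; first by move=> _ [].
have recl (c : 'I_d.+1 -> nat) :
    (\sum_i c i * B ^ i = (\sum_(i < d) c (lift ord0 i) * B ^ i) * B + c ord0)%N.
  rewrite big_ord_recl muln1 addnC; congr (_ + _)%N.
  by rewrite big_distrl; apply: eq_bigr => i _; rewrite expnSr mulnA.
rewrite !recl => eq_ab.
have B0 : (0 < B)%N by apply: leq_ltn_trans (aB ord0).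
have eq0 : a ord0 = b ord0.
  by move/(congr1 (modn^~ B)): eq_ab; rewrite !modnMDl !modn_small.
move: eq_ab; rewrite eq0 => /addIn/eqP; rewrite eqn_pmul2r // => /eqP eq_ab i.
case: (unliftP ord0 i) => [j ->|-> //].
exact: (IHd (fun j => a (lift ord0 j)) (fun j => b (lift ord0 j))).
Qed.

(* Kronecker substitution: X_i := t ^ (B ^ i) sends distinct monomials of p to
   distinct powers of t as soon as B bounds the exponents. *)
Lemma mpoly_exists_neq0 d (p : {mpoly R[d]}) : p != 0 -> exists v, p.@[v] != 0.
Proof.
move=> p0; pose B := msize p; pose w (m : 'X_{1..d}) := (\sum_i m i * B ^ i)%N.
have ltB m i : m \in msupp p -> (m i < B)%N.
  move=> /msize_mdeg_lt; apply: leq_ltn_trans.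
  by rewrite mdegE (bigD1 i) //= leq_addr.
have w_inj : {in msupp p &, injective w}.
  move=> m1 m2 p1 p2 /base_expansion_inj eq12; apply/mnmP.
  by apply: eq12 => i; apply: ltB.
pose q : {poly R} := \sum_(m <- msupp p) p@_m *: 'X^(w m).
have [|t qt] := @exists_nonroot q.
  have p0m := mlead_supp p0; apply: contraTneq p0m => q0.
  rewrite mcoeff_msupp negbK.
  (* By [w_inj], only the leading monomial of [p] contributes to this coefficient of [q]. *)
  have := congr1 (fun r : {poly R} => r`_(w (mlead p))) q0.
  rewrite coef0 coef_sum (bigD1_seq (mlead p)) ?mlead_supp ?msupp_uniq //=.
  rewrite coefZ coefXn eqxx mulr1 big_seq_cond big1 ?addr0 => [->//|m].
  move=> /andP[pm neq]; rewrite coefZ coefXn.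
  case: eqP => [eqw|]; rewrite ?mulr0 //.
  by rewrite (w_inj _ _ _ _ eqw) ?mlead_supp ?eqxx in neq.
exists (fun i : 'I_d => t ^+ (B ^ i)); rewrite mevalE.
apply: contraNneq qt => p0'; rewrite -[0]p0' /q horner_sum; apply/eqP.
apply: eq_bigr => m _; rewrite hornerZ hornerXn; congr (_ * _).
by rewrite expr_sum; apply: eq_bigr => i _; rewrite -exprM mulnC.
Qed.

End Nonvanishing.

(** * The Fischer form and its reproducing property *)

Section FischerForm.
Variables (R : comNzRingType) (d : nat).
Implicit Types (p q : {mpoly R[d]}) (m : 'X_{1..d}).

Definition mnm_fact m : nat := \prod_i (m i)`!.

Lemma mnm_factMU m i : mnm_fact (m + U_(i)) = ((m i).+1 * mnm_fact m)%N.
Proof.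
rewrite /mnm_fact (bigD1 i) //= [in RHS](bigD1 i) //= mulnA -factS.
rewrite mnmDE mnm1E eqxx addn1; congr (_ * _)%N; apply: eq_bigr => j ji.
by rewrite mnmDE mnm1E eq_sym (negPf ji) addn0.
Qed.

(* The cutoff k makes the sum finite: only degrees less than k contribute. *)
Definition fischer k p q : R :=
  \sum_(m : 'X_{1..d < k}) p@_m * q@_m * (mnm_fact m)%:R.

Lemma fischer_is_linear k q : linear_for *%R (fischer k q).
Proof.
move=> c p p'; rewrite /fischer mulr_sumr -big_split; apply: eq_bigr => m _ /=.
by rewrite mcoeffD mcoeffZ; ring.
Qed.

HB.instance Definition _ k q :=
  GRing.isLinear.Build R {mpoly R[d]} R *%R (fischer k q)
    (fischer_is_linear k q).

Lemma fischerC k p q : fischer k p q = fischer k q p.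
Proof. by apply: eq_bigr => m _; rewrite [_ * q@__]mulrC. Qed.

Lemma fischerPl k c p p' q :
  fischer k (c *: p + p') q = c * fischer k p q + fischer k p' q.
Proof. by rewrite fischerC fischer_is_linear !(fischerC k q). Qed.

Lemma fischerZl k c p q : fischer k (c *: p) q = c * fischer k p q.
Proof. by rewrite fischerC linearZ fischerC. Qed.

Lemma fischer_suml k (I : Type) (r : seq I) (P : pred I) F q :
  fischer k (\sum_(i <- r | P i) F i) q = \sum_(i <- r | P i) fischer k (F i) q.
Proof.
by rewrite fischerC linear_sum; apply: eq_bigr => i _; rewrite fischerC.
Qed.

Lemma fischer_mpolyX k m q :
  fischer k 'X_[m] q = if (mdeg m < k)%N then q@_m * (mnm_fact m)%:R else 0.
Proof.
case: ifPn => [ltmk|]; last first.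
  move=> gemk; apply: big1 => m' _; rewrite mcoeffX; case: eqP => [eqm|_].
    by rewrite eqm bmdeg in gemk.
  by rewrite !mul0r.
rewrite /fischer (bigD1 (BMultinom ltmk)) //= mcoeffX eqxx mul1r big1 ?addr0 //.
move=> m' neqm; rewrite mcoeffX; case: eqP => [eqm|_]; last by rewrite !mul0r.
by case/eqP: neqm; apply: val_inj.
Qed.

(** On monomials, the factor m_i + 1 that differentiation puts on a coefficient is the ratio (m +
    U_i)! / m!. The cutoff shifts by one along with the degree. *)
Lemma fischer_mulX k i p q :
  fischer k.+1 ('X_i * p) q = fischer k p (q^`M(i)).
Proof.
elim/mpolyind: p => [|c m p _ _ IHp].
  by rewrite mulr0 ![fischer _ 0 _]fischerC !linear0.
rewrite mulrDr -scalerAr !fischerPl IHp -mpolyXD addmC !fischer_mpolyX.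
rewrite mdegD mdeg1 addn1 ltnS; case: ifP => // _.
by rewrite mcoeff_mderiv mnm_factMU natrM mulrA -[q@__ *+ _]mulr_natr.
Qed.

Definition mpoly_linform (y : 'I_d -> R) : {mpoly R[d]} := \sum_i y i *: 'X_i.

Lemma linform_homog y : mpoly_linform y \is 1.-homog.
Proof.
by apply: rpred_sum => i _; apply: rpredZ; rewrite dhomogX; apply/eqP/mdeg1.
Qed.

Lemma Euler_identity n p : p \is n.-homog ->
  \sum_i 'X_i * p^`M(i) = n%:R *: p.
Proof.
move=> hp; have derE i : p^`M(i) = \sum_(m <- msupp p) p@_m *: 'X_[m]^`M(i).
  rewrite {1}[p]mpolyE (raddf_sum (mderiv i)).
  by apply: eq_bigr => m _ /=; rewrite mderivZ.
under eq_bigr => i _ do rewrite derE mulr_sumr.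
rewrite exchange_big [p in RHS]mpolyE scaler_sumr.
apply: eq_big_seq => m pm /=.
rewrite -(dhomog_mf hp pm) /= mdegE natr_sum scaler_suml.
apply: eq_bigr => i _; rewrite mderivX -!scalerAr scalerA mulrC.
(* If m_i = 0, the truncated m - U_i does not add back to m, but the factor m_i kills the term. *)
case: (posnP (m i)) => [->|mi]; first by rewrite !(mul0r, mulr0, scale0r).
by rewrite -mpolyXD addmC submK ?scalerA // lep1mP -lt0n.
Qed.

Lemma dhomog0_const p : p \is 0.-homog -> p = (p@_0)%:MP.
Proof.
move=> hp; apply/mpolyP => m; rewrite mcoeffC.
have [-> | m0] := eqVneq; first by rewrite mulr1.
by rewrite mulr0 (dhomog_nemf_coeff hp) //= mdeg_eq0.
Qed.

Lemma fischer_mul_sqnorm k p q :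
  fischer k.+2 ((\sum_i 'X_i ^+ 2) * p) q = fischer k p (\sum_i q^`M(i)^`M(i)).
Proof.
rewrite mulr_suml fischer_suml linear_sum; apply: eq_bigr => i _.
by rewrite expr2 -mulrA !fischer_mulX.
Qed.

End FischerForm.

(** Moving one factor y.X across the form turns p into its derivative along y. Induction evaluates
    this at y, and Euler's identity contributes the remaining factor n + 1. *)
Lemma fischer_linform_exp (R : realType) d n (p : {mpoly R[d]}) y :
  p \is n.-homog ->
  fischer n.+1 (mpoly_linform y ^+ n) p = n`!%:R * p.@[y].
Proof.
elim: n p => [|n IHn] p hp.
  rewrite expr0 -mpolyX0 fischer_mpolyX mdeg0 /= /mnm_fact big1 => [|i _]; last first.
    by rewrite mnm0E.
  by rewrite mulr1 mul1r {2}[p]dhomog0_const // mevalC.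
rewrite exprS mulr_suml fischer_suml.
under eq_bigr => i _.
  rewrite -scalerAl fischerZl fischer_mulX IHn; last exact: (mderiv_homog i hp).
  over.
rewrite factS natrM -mulrA mulrCA -mevalZ -(Euler_identity hp) raddf_sum mulr_sumr.
by apply: eq_bigr => i _ /=; rewrite mevalM mevalXU; ring.
Qed.

Lemma fischer_gt0 (R : realDomainType) d k (p : {mpoly R[d]}) :
  p != 0 -> (msize p <= k)%N -> 0 < fischer k p p.
Proof.
move=> p0 pk; have ltk : (mdeg (mlead p) < k)%N.
  exact: leq_trans (msize_mdeg_lt (mlead_supp p0)) pk.
have ge0 (m : 'X_{1..d}) : 0 <= p@_m * p@_m * (mnm_fact m)%:R.
  by rewrite mulr_ge0 // -expr2 sqr_ge0.
rewrite /fischer (bigD1 (BMultinom ltk)) //= ltr_wpDr ?sumr_ge0 //.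
rewrite mulr_gt0 ?ltr0n ?prodn_gt0 // => [|i]; last exact: fact_gt0.
by rewrite -expr2 exprn_even_gt0 //= mleadc_eq0.
Qed.

(** * Evaluation of homogeneous polynomials on the sphere *)

Section Sphere.
Variables (R : realType) (d : nat).
Implicit Types (p q : {mpoly R[d]}) (x y : 'rV[R]_d).

Definition mpoly_sqnorm : {mpoly R[d]} := \sum_i 'X_i ^+ 2.

Lemma sqnorm_homog : mpoly_sqnorm \is 2.-homog.
Proof.
apply: rpred_sum => i _; rewrite -[2%N]mul1n; apply: dhomogMn.
by rewrite dhomogX; apply/eqP/mdeg1.
Qed.

Lemma meval_sqnormE v : mpoly_sqnorm.@[v] = \sum_i v i ^+ 2.
Proof.
rewrite /mpoly_sqnorm raddf_sum; apply: eq_bigr => i _ /=.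
by rewrite rmorphXn /= mevalXU.
Qed.

Lemma meval_sqnorm x : mpoly_sqnorm.@[x 0] = inner x x.
Proof. by rewrite meval_sqnormE; apply: eq_bigr => i _; rewrite expr2. Qed.

Lemma meval_linform x y : (mpoly_linform (y 0)).@[x 0] = inner x y.
Proof.
rewrite /mpoly_linform raddf_sum; apply: eq_bigr => i _ /=.
by rewrite mevalZ mevalXU mulrC.
Qed.

Lemma on_unit_sphereP x : on_unit_sphere x <-> inner x x = 1.
Proof.
rewrite /on_unit_sphere /euclidean_norm; split=> [x1|->]; last exact: sqrtr1.
rewrite -[LHS]sqr_sqrtr ?x1 ?expr1n // sumr_ge0 // => i _.
by rewrite -expr2 sqr_ge0.
Qed.

Lemma meval_homogZ n p c v : p \is n.-homog ->
  p.@[fun i => c * v i] = c ^+ n * p.@[v].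
Proof.
move=> hp; rewrite !mevalE mulr_sumr; apply: eq_big_seq => m pm.
rewrite mulrCA -(dhomog_mf hp pm) /= mdegE expr_sum -big_split.
by congr (_ * _); apply: eq_bigr => i _; rewrite exprMn.
Qed.

Lemma homog_sphere_neq0 n p : (0 < d)%N -> p \is n.-homog -> p != 0 ->
  exists2 x, on_unit_sphere x & p.@[x 0] != 0.
Proof.
move=> d_gt0 hp p0; have sq0 : mpoly_sqnorm != 0.
  apply/eqP => /(congr1 (meval (fun=> 1))) /eqP; rewrite meval0 meval_sqnormE.
  by rewrite expr1n sumr_const card_ord pnatr_eq0 gtn_eqF.
(* The extra factor |X|^2 forces v to be nonzero, even when p is constant, so that v can be
   normalized. *)
have [|v] := mpoly_exists_neq0 (p := mpoly_sqnorm * p).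
  by rewrite mulf_neq0.
rewrite mevalM mulf_eq0 => /norP [sv pv].
set s := mpoly_sqnorm.@[v] in sv.
have s_ge0 : 0 <= s.
  by rewrite /s meval_sqnormE sumr_ge0 // => i _; exact: sqr_ge0.
have rowE q : q.@[(\row_i ((Num.sqrt s)^-1 * v i)) 0] =
              q.@[fun i => (Num.sqrt s)^-1 * v i].
  by apply: meval_eq => i; rewrite mxE.
exists (\row_i ((Num.sqrt s)^-1 * v i)).
  apply/on_unit_sphereP; rewrite -meval_sqnorm rowE.
  by rewrite (meval_homogZ _ _ sqnorm_homog) -/s exprVn sqr_sqrtr // mulVf.
rewrite rowE (meval_homogZ _ _ hp) mulf_neq0 // expf_neq0 // invr_neq0 //.
by rewrite sqrtr_eq0 -ltNge lt0r sv.
Qed.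

End Sphere.

(** * Laplacians of products and the zonal harmonics *)

HB.instance Definition _ (R : realType) d :=
  GRing.isLinear.Build R {mpoly R[d]} {mpoly R[d]} _ (@laplacian R d)
    (@laplacian_is_linear R d).

Section Zonal.
Variables (R : realType) (d : nat).
Implicit Types (p q : {mpoly R[d]}) (y : 'I_d -> R).

Lemma mderiv_exp p k i :
  (p ^+ k.+1)^`M(i) = k.+1%:R *: (p ^+ k * p^`M(i)).
Proof.
elim: k => [|k IHk]; first by rewrite expr1 expr0 mul1r scale1r.
rewrite exprS mderivM IHk -scalerAr mulrA -exprS [_^`M(i) * _]mulrC.
by rewrite -{1}[p ^+ _ * _]scale1r -scalerDl nat1r.
Qed.

Lemma mderivXU i j : ('X_j : {mpoly R[d]})^`M(i) = (i == j)%:R%:MP.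
Proof.
rewrite mderivX mnm1E eq_sym; case: eqP => [->|_]; last first.
  by rewrite scale0r.
by rewrite -[X in (X - _)%MM]add0m addmK mpolyX0 scale1r.
Qed.

Lemma mderiv_linform y i : (mpoly_linform y)^`M(i) = (y i)%:MP.
Proof.
rewrite /mpoly_linform (raddf_sum (mderiv i)) (bigD1 i) //= big1 => [|j ji].
  by rewrite addr0 mderivZ mderivXU eqxx -mul_mpolyC mulr1.
by rewrite mderivZ mderivXU eq_sym (negPf ji) scaler0.
Qed.

Lemma mderiv_sqnorm i : (mpoly_sqnorm R d)^`M(i) = 2 *: 'X_i.
Proof.
rewrite /mpoly_sqnorm (raddf_sum (mderiv i)) (bigD1 i) //= big1 => [|j ji].
  by rewrite addr0 mderiv_exp mderivXU eqxx mulr1 expr1.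
by rewrite mderiv_exp mderivXU eq_sym (negPf ji) mulr0 scaler0.
Qed.

Lemma laplacian_linform_exp y m :
  laplacian (mpoly_linform y ^+ m) =
  (m%:R * (m%:R - 1) * \sum_i y i ^+ 2) *: mpoly_linform y ^+ (m - 2).
Proof.
rewrite /laplacian; case: m => [|[|m]].
- rewrite !mul0r scale0r big1 // => i _.
  by rewrite expr0 -mpolyC1 mderivC mderiv0.
- rewrite subrr mulr0 mul0r scale0r big1 // => i _.
  by rewrite expr1 mderiv_linform mderivC.
rewrite !subSS subn0 mulr_sumr scaler_suml; apply: eq_bigr => i _.
rewrite mderiv_exp mderiv_linform [_ * _%:MP]mulrC mul_mpolyC !mderivZ.
rewrite mderiv_exp mderiv_linform [_ * _%:MP]mulrC mul_mpolyC !scalerA.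
by congr (_ *: _); rewrite -[m.+2%:R]natr1 -[m.+1%:R]natr1; ring.
Qed.

(** The Laplacian of |X|^2 is 2d; the cross terms sum to 4 times the sum of X_i d_i p, which is 4n p
    by Euler's identity. *)
Lemma laplacian_sqnormM n p : p \is n.-homog ->
  laplacian (mpoly_sqnorm R d * p) =
  (2 * d%:R + 4 * n%:R) *: p + mpoly_sqnorm R d * laplacian p.
Proof.
move=> hp; rewrite scalerDl -(scalerA 4) -(Euler_identity hp) /laplacian.
have -> : (2 * d%:R) *: p = \sum_(i < d) 2 *: p.
  by rewrite sumr_const card_ord mulr_natr scalerMnl.
rewrite scaler_sumr mulr_sumr -!big_split; apply: eq_bigr => i _ /=.
rewrite mderivM mderivD mderiv_sqnorm !mderivM mderivZ mderivXU eqxx.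
by rewrite mderiv_sqnorm -!mul_mpolyC !mpolyC_nat mulr1; ring.
Qed.

Lemma sqnorm_exp_homog j : mpoly_sqnorm R d ^+ j \is (2 * j).-homog.
Proof. exact/dhomogMn/sqnorm_homog. Qed.

Lemma linform_exp_homog y m : mpoly_linform y ^+ m \is m.-homog.
Proof. by rewrite -[m in m.-homog]mul1n; apply/dhomogMn/linform_homog. Qed.

Lemma laplacian_sqnorm_linform y m j :
  laplacian (mpoly_sqnorm R d ^+ j * mpoly_linform y ^+ m) =
  (2 * j%:R * (d%:R + 2 * j%:R - 2 + 2 * m%:R)) *:
     (mpoly_sqnorm R d ^+ j.-1 * mpoly_linform y ^+ m) +
  (m%:R * (m%:R - 1) * \sum_i y i ^+ 2) *:
     (mpoly_sqnorm R d ^+ j * mpoly_linform y ^+ (m - 2)).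
Proof.
elim: j => [|j IHj].
  by rewrite !mul1r mulr0 mul0r scale0r add0r laplacian_linform_exp.
rewrite exprS -mulrA (@laplacian_sqnormM (2 * j + m)%N); last first.
  by apply: dhomogM; [apply: sqnorm_exp_homog|apply: linform_exp_homog].
rewrite IHj mulrDr -!scalerAr !mulrA -!exprS addrA; congr (_ + _).
(* At j = 0 the truncated exponent [j.-1] is harmless, since its term has coefficient 0. *)
case: j {IHj} => [|j] /=.
  rewrite !mulr0 mul0r scale0r addr0; congr (_ *: _).
  by rewrite muln0 add0n; ring.
rewrite -scalerDl; congr (_ *: _).
by rewrite natrD natrM -[j.+2%:R]natr1; ring.
Qed.

Section ZonalPolynomial.
Variables (lambda : R) (n : nat).

Definition zonal_coef j : R :=
  pochhammer (- (n%:R / 2)) j * pochhammer ((1 - n%:R) / 2) j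
    / (j`!%:R * pochhammer (1 - n%:R - lambda) j).

(** The sum in [gegenbauer], homogenized to degree n: t becomes y.X, and powers of |X|^2 make up the
    missing degree. *)
Definition zonal y : {mpoly R[d]} :=
  \sum_(j < n./2.+1)
    zonal_coef j *: (mpoly_sqnorm R d ^+ j * mpoly_linform y ^+ (n - 2 * j)).

Lemma zonal_homog y : zonal y \is n.-homog.
Proof.
apply: rpred_sum => j _; apply: rpredZ.
have le2j : (2 * j <= n)%N by have := ltn_ord j; lia.
have := dhomogM (sqnorm_exp_homog j) (linform_exp_homog y (n - 2 * j)).
by rewrite subnKC.
Qed.

Lemma zonal_coef0 : zonal_coef 0 = 1.
Proof. by rewrite /zonal_coef /pochhammer !big_ord0 fact0 !mulr1 divr1. Qed.

(** This is the ratio of consecutive coefficients with denominators cleared, in the shape needed for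
    the Laplacian of [zonal] to telescope; the 4 clears the two halves in the numerator. The
    hypotheses keep the Pochhammer factors of the denominator nonzero. *)
Lemma zonal_coef_recl j : 0 < lambda -> (j < n)%N ->
  4 * j.+1%:R * (lambda + n%:R - 1 - j%:R) * zonal_coef j.+1 =
  - ((n%:R - 2 * j%:R) * (n%:R - 2 * j%:R - 1)) * zonal_coef j.
Proof.
move=> lambda0 ltjn; rewrite /zonal_coef /pochhammer !big_ord_recr /=.
rewrite factS natrM.
have fj : j`!%:R != 0 :> R by rewrite pnatr_eq0 -lt0n fact_gt0.
have factor_neq0 i : (i < n)%N -> 1 - n%:R - lambda + i%:R != 0 :> R.
  move=> ltin; apply: ltr0_neq0.
  have : i%:R + 1 <= n%:R :> R by rewrite natr1 ler_nat.
  by lra.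
have pj : \prod_(i < j) (1 - n%:R - lambda + i%:R) != 0.
  by apply/prodf_neq0 => i _; apply/factor_neq0/(ltn_trans _ ltjn).
have := factor_neq0 _ ltjn.
rewrite -natr1; have : j%:R + 1 != 0 :> R by rewrite natr1 pnatr_eq0.
move: (\prod_(i < j) _) pj => P P0; move: (\prod_(i < j) _) => P1.
move: (\prod_(i < j) _) => P2 j1 nj; field.
by rewrite P0 fj nj addrC j1.
Qed.

Lemma laplacian_zonal y : 0 < lambda -> d%:R = 2 * lambda + 2 ->
  \sum_i y i ^+ 2 = 1 -> laplacian (zonal y) = 0.
Proof.
move=> lambda0 dE y1; rewrite /zonal linear_sum.
(* The Laplacian of the j-th term has two parts: [c j] goes with the lowered power of |X|^2, [e j]
   with the lowered power of y.X. *)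
pose c j : R :=
  zonal_coef j * (2 * j%:R * (d%:R + 2 * j%:R - 2 + 2 * (n - 2 * j)%:R)).
pose e j : R := zonal_coef j * ((n - 2 * j)%:R * ((n - 2 * j)%:R - 1)).
transitivity (\sum_(j < n./2.+1) c j *:
    (mpoly_sqnorm R d ^+ j.-1 * mpoly_linform y ^+ (n - 2 * j)) +
  \sum_(j < n./2.+1) e j *:
    (mpoly_sqnorm R d ^+ j * mpoly_linform y ^+ (n - 2 * j - 2))).
  rewrite -big_split; apply: eq_bigr => j _ /=.
  by rewrite linearZ /= laplacian_sqnorm_linform y1 mulr1 scalerDr !scalerA.
(* After a shift of index, [c j.+1] meets [e j] on the same monomial. The unpaired end terms vanish,
   the last because n - 2 * n./2 is 0 or 1. *)
rewrite big_ord_recl big_ord_recr /=.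
have -> : c 0%N = 0 by rewrite /c mulr0 mul0r mulr0.
have -> : e n./2 = 0.
  rewrite /e; have -> : (n - 2 * n./2 = odd n)%N by lia.
  by case: odd; rewrite ?subrr ?mul0r ?mulr0.
rewrite !scale0r add0r addr0 -big_split big1 // => j _ /=.
rewrite -subnDA [(2 * j + 2)%N]addnC -mulnS -scalerDl.
suff -> : c j.+1 + e j = 0 by rewrite scale0r.
have le2j : (2 * j.+1 <= n)%N by have := ltn_ord j; lia.
have ltjn : (j < n)%N by lia.
have := zonal_coef_recl lambda0 ltjn; rewrite /c /e.
rewrite !natrB ?natrM ?dE -?[j.+1%:R]natr1; [|lia|exact: le2j].
rewrite -mulNr => /eqP; rewrite -subr_eq0 => /eqP <-; ring.
Qed.

Lemma fischer_zonal y q : q \is n.-homog -> laplacian q = 0 ->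
  fischer n.+1 (zonal y) q = n`!%:R * q.@[y].
Proof.
move=> hq q0; rewrite /zonal fischer_suml big_ord_recl big1 => [|j _].
  by rewrite addr0 zonal_coef0 scale1r mul1r muln0 subn0 fischer_linform_exp.
(* A term of positive index exists only for n >= 2. It contains a factor |X|^2, whose adjoint, the
   Laplacian, kills q. *)
have -> : n.+1 = n.-1.+2 by have := ltn_ord j; lia.
rewrite fischerZl exprS -mulrA fischer_mul_sqnorm -/(laplacian q) q0.
by rewrite linear0 mulr0.
Qed.

End ZonalPolynomial.
End Zonal.

(** * The Gegenbauer matrix as a Gram matrix *)

Lemma pochhammer_gt0 (R : realType) (a : R) k : 0 < a -> 0 < pochhammer a k.
Proof. by move=> a0; apply: prodr_gt0 => i _; rewrite ltr_pwDl. Qed.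

Lemma gegenbauer_zonal (R : realType) d n (lambda : R) (x y : 'rV[R]_d) :
  on_unit_sphere x ->
  (gegenbauer lambda n).[inner x y] =
  (pochhammer lambda n * 2 ^+ n / n`!%:R) * (zonal lambda n (y 0)).@[x 0].
Proof.
move=> /on_unit_sphereP x1; rewrite hornerZ horner_sum; congr (_ * _).
rewrite raddf_sum; apply: eq_bigr => j _ /=.
rewrite hornerZ hornerXn mevalZ mevalM !rmorphXn /= meval_sqnorm x1 expr1n mul1r.
by rewrite meval_linform.
Qed.

(** The points make the square matrix of values of a basis of harmonics row free. The conclusion
    restates this as independence of the evaluations, free of the basis. *)
Lemma harmonic_points (R : realType) d n :
  exists2 x : 'I_(\dim (harmonic R d.+1 n)) -> 'rV[R]_d.+1,
    (forall i, on_unit_sphere (x i)) &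
    (forall v : 'rV_(\dim (harmonic R d.+1 n)),
       (forall p : {mpoly R[d.+1]}, p \is n.-homog -> laplacian p = 0 ->
          \sum_i v 0 i * p.@[x i 0] = 0) -> v = 0).
Proof.
set H := harmonic R d.+1 n; set N := \dim H.
pose b (k : 'I_N) : dhomog d.+1 R n := (vbasis H)`_k.
pose f (x : 'rV[R]_d.+1) := \row_k (mpoly_of_dhomog (b k)).@[x 0].
have [c c0|x x1 /row_freeP [B fxB]] := @exists_row_free R _ (@on_unit_sphere R _) N f.
  (* A column c is the coordinate vector of a harmonic h, and f(y) c = h(y), so a point of the
     sphere where h is nonzero separates c. *)
  pose h := \sum_k c k 0 *: b k.
  have h0 : mpoly_of_dhomog h != 0.
    apply: contraNneq c0 => h0; apply/eqP/colP => k; rewrite mxE.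
    have /freeP/(_ (fun k => c k 0)) free_c := basis_free (vbasisP H).
    by apply: free_c; apply: val_inj.
  have [y y1 hy] := homog_sphere_neq0 (ltn0Sn d) (dhomog_is_dhomog h) h0.
  exists y => //; apply: contraNneq hy => fc.
  move/matrixP/(_ 0 0): fc; rewrite !mxE => <-; apply/eqP.
  rewrite /h raddf_sum raddf_sum; apply: eq_bigr => k _ /=.
  by rewrite mevalZ mxE mulrC.
exists x => // v hv; rewrite -[v]mulmx1 -fxB mulmxA.
suff -> : v *m \matrix_i f (x i) = 0 by rewrite mul0mx.
apply/rowP => k; rewrite !mxE -[RHS](hv (b k)); last 2 first.
- exact: dhomog_is_dhomog.
- by apply/(@harmonicP R d.+1 n)/vbasis_mem/mem_nth; rewrite size_tuple.
by apply: eq_bigr => i _; rewrite !mxE.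
Qed.

Theorem lemma3p2 (R : realType) (d n : nat) (hd : (3 <= d)%N) :
  exists x : 'I_(\dim (harmonic R d n)) -> 'rV[R]_d, fundamental_system x.
Proof.
case: d hd => // d hd; have [x x1 x_indep] := harmonic_points R d n.
exists x; split=> //; apply: det_gt0_of_posdef => v v0.
set lambda := (_ / 2); set C := pochhammer lambda n * 2 ^+ n / n`!%:R.
have d3 : 3 <= d.+1%:R :> R by rewrite ler_nat.
have lambda0 : 0 < lambda by rewrite divr_gt0 // subr_gt0; lra.
have dE : d.+1%:R = 2 * lambda + 2 :> R by rewrite /lambda; field.
have C0 : 0 < C.
  by rewrite divr_gt0 ?ltr0n ?fact_gt0 // mulr_gt0 ?pochhammer_gt0 ?exprn_gt0.
pose Z i := zonal lambda n (x i 0).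
have harmZ i : laplacian (Z i) = 0.
  apply: laplacian_zonal => //; have /on_unit_sphereP <- := x1 i.
  by apply: eq_bigr => j _; rewrite expr2.
(* The quadratic form of the matrix at v is C / n! times the Fischer square of this combination. *)
pose q := \sum_i v 0 i *: Z i.
have homq : q \is n.-homog.
  by apply: rpred_sum => i _; apply/rpredZ/zonal_homog.
have fact0 : n`!%:R != 0 :> R by rewrite pnatr_eq0 -lt0n fact_gt0.
have -> : (v *m \matrix_(i, j) (gegenbauer lambda n).[inner (x i) (x j)] *m v^T)
    0 0 = C / n`!%:R * fischer n.+1 q q.
  rewrite {1}/q fischer_suml mulr_sumr mxE; under eq_bigr do rewrite mxE mulr_suml.
  rewrite exchange_big; apply: eq_bigr => i _ /=.
  rewrite fischerZl linear_sum !mulr_sumr; apply: eq_bigr => j _ /=.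
  rewrite !mxE linearZ /= fischer_zonal ?zonal_homog //.
  by rewrite gegenbauer_zonal // -/C; field.
rewrite mulr_gt0 //; first by apply: divr_gt0; rewrite ?ltr0n ?fact_gt0.
apply: fischer_gt0.
  (* If q = 0, pairing it with any harmonic p gives n! times the sum of the v_i p(x_i), so this sum
     is 0 and v = 0 by the choice of the points. *)
  apply: contraNneq v0 => q0; apply/eqP/x_indep => p hp p0.
  have : fischer n.+1 q p / n`!%:R = 0 by rewrite q0 fischerC linear0 mul0r.
  rewrite fischer_suml mulr_suml; apply: etrans; apply: eq_bigr => i _.
  by rewrite fischerZl fischer_zonal //; field.
rewrite msizeE; apply/bigmax_leqP_seq => m qm _.
by rewrite ltnS -(dhomog_mf homq qm).
Qed.
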